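(* Let $r\ge 1$ and $d\ge 2$ be integers. There exists a nonzero rational scalar $\kappa_{r,d}$ such that $\mathfrak G_{r,d}=\kappa_{r,d}\,\mathcal H_{r,d}$, i.e. $\mathfrak G_{r,d}(\mathbb F)=\kappa_{r,d}\,\mathcal H_{r,d}(\mathbb F)$ as polynomials in $\mathbf C[a_0,\dots,a_d;x_1,x_2]$, where $\mathbb F$ is the generic binary form of order $d$.
   Context: The base field is $\mathbf C$. Let $\mathbb F=\sum_{i=0}^d\binom di a_i x_1^{d-i}x_2^i$ be the generic binary form of order (i.e. homogeneous degree) $d$, with independent indeterminates $a_0,\dots,a_d$. Put $N=(r+1)(d-2)$. Definition of $\mathfrak G_{r,d}$. For binary forms $A$ of order $r$ and $F$ of order $d$ put $(A,F)_1=\frac1{rd}\left(\frac{\partial A}{\partial x_1}\frac{\partial F}{\partial x_2}-\frac{\partial A}{\partial x_2}\frac{\partial F}{\partial x_1}\right)$. Let $C_i=(x_1^{r-i}x_2^i,F)_1$ for $0\le i\le r$. Then $\mathfrak G_{r,d}(F)$ is the determinant of the $(r+1)\times(r+1)$ matrix with $(i,j)$ entry $\frac{\partial^r C_i}{\partial x_1^{r-j}\partial x_2^j}$, $0\le i,j\le r$. It is homogeneous of degree $r+1$ in the coefficients of $F$ and of order $N$ in $x_1,x_2$. Definition of $\mathcal H_{r,d}$. Let $E_+=\sum_{i=0}^{d-1}(d-i)\,a_{i+1}\frac{\partial}{\partial a_i}$. It acts as a derivation also on expressions involving rational powers of $a_0$, with $E_+(a_0^s)=s\,d\,a_0^{s-1}a_1$.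 Define $$h_0=a_0^{\,r+1-\frac rd}\,E_+^{\,r+1}\bigl(a_0^{\frac rd}\bigr),$$ which is a polynomial in the $a_i$, and $h_k=\frac{(N-k)!}{N!}E_+^k(h_0)$ for $0\le k\le N$. Then $\mathcal H_{r,d}(\mathbb F)=\sum_{k=0}^N\binom Nk h_k\,x_1^{N-k}x_2^k$. *)

(* Defs.v *)
From mathcomp Require Import all_boot all_order all_algebra.
From mathcomp Require Import mpoly.
From mathcomp Require Import reals complex.

Set Implicit Arguments.
Unset Strict Implicit.
Unset Printing Implicit Defensive.

Import GRing.Theory.
Local Open Scope ring_scope.

(* Binary forms with coefficients in A are elements of {mpoly A[2]}, with
   x_1 = 'X_ord0 and x_2 = 'X_ord_max.  In the application A is the polynomial
   ring C[a_0, ..., a_d]. *)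
Definition x1 {A : comNzRingType} : {mpoly A[2]} := 'X_ord0.
Definition x2 {A : comNzRingType} : {mpoly A[2]} := 'X_ord_max.

Definition dx1 (A : comNzRingType) (f : {mpoly A[2]}) := f^`M(ord0).
Definition dx2 (A : comNzRingType) (f : {mpoly A[2]}) := f^`M(ord_max).

Section Evectant.
Variables (C : fieldType) (A : comAlgType C).
Implicit Types f g : {mpoly A[2]}.

(* The first transvectant (f, g)_1 of forms of orders r and d; the orders are
   arguments because they cannot be read off a zero form. *)
Definition transvectant1 (r d : nat) f g : {mpoly A[2]} :=
  (((r * d)%:R^-1 : C)%:A : A) *: (dx1 f * dx2 g - dx2 f * dx1 g).

Definition Gform (r d : nat) (F : {mpoly A[2]}) : {mpoly A[2]} :=
  \det (\matrix_(i < r.+1, j < r.+1)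
          iter (r - j) (@dx1 A)
            (iter j (@dx2 A) (transvectant1 r d (x1 ^+ (r - i) * x2 ^+ i) F))).

End Evectant.

Section Hform.
Variables (C : fieldType) (d : nat).
Local Notation Ca := {mpoly C[d.+1]}.

(* Only meaningful for i <= d. *)
Definition acoef (i : nat) : Ca := 'X_(inord i).

Definition generic_form : {mpoly Ca[2]} :=
  \sum_(i < d.+1) (acoef i *+ 'C(d, i)) *: (x1 ^+ (d - i) * x2 ^+ i).

Definition Eplus (p : Ca) : Ca :=
  \sum_(i < d) acoef i.+1 * p^`M(inord i) *+ (d - i).

(* PowExpr s p stands for the expression a_0^s p, with s a rational number. *)
Record powexpr := PowExpr { pow_exp : rat; pow_coef : Ca }.

Definition a0pow (s : rat) : powexpr := PowExpr s 1.

Definition mulpow (u v : powexpr) : powexpr :=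
  PowExpr (pow_exp u + pow_exp v) (pow_coef u * pow_coef v).

(* The Leibniz rule with E_+(a_0^s) = s d a_0^(s-1) a_1:
     E_+(a_0^s p) = a_0^(s-1) (s d a_1 p + a_0 E_+(p)). *)
Definition Epow (u : powexpr) : powexpr :=
  PowExpr (pow_exp u - 1)
    ((ratr (pow_exp u * d%:R) : C) *: (acoef 1 * pow_coef u)
     + acoef 0 * Eplus (pow_coef u)).

Definition h0expr (r : nat) : powexpr :=
  mulpow (a0pow (r.+1%:R - r%:R / d%:R))
         (iter r.+1 Epow (a0pow (r%:R / d%:R))).

(* h0expr r has exponent 0 (h0expr_exp below), so that it is the polynomial
   given by its second component. *)
Definition h0 (r : nat) : Ca := pow_coef (h0expr r).

Definition orderN (r : nat) : nat := (r.+1 * (d - 2))%N.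

Definition hcoef (r k : nat) : Ca :=
  ((orderN r - k)`!%:R / (orderN r)`!%:R : C) *: iter k Eplus (h0 r).

Definition Hform (r : nat) : {mpoly Ca[2]} :=
  \sum_(k < (orderN r).+1)
    (hcoef r k *+ 'C(orderN r, k)) *: (x1 ^+ (orderN r - k) * x2 ^+ k).

Lemma h0expr_exp r : pow_exp (h0expr r) = 0.
Proof.
have expE n u : pow_exp (iter n Epow u) = pow_exp u - n%:R.
  by elim: n => [|n IHn] /=; rewrite ?subr0 // IHn -addrA -opprD natr1.
by rewrite [LHS]/= -/(iter r.+1 Epow _) -[_ - 1]/(pow_exp (iter r.+1 Epow _)) expE /=
  addrA subrK subrr.
Qed.

(* In every commutative C-algebra L over C[a_0, ..., a_d] that contains
   rational powers of a_0 and to which E_+ extends as a derivation D with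
   D(a_0^s) = s d a_0^(s-1) a_1, the image of h0 r is
   a_0^(r+1-r/d) D^(r+1)(a_0^(r/d)). *)
Lemma h0E (L : comAlgType C) (iota : {lrmorphism Ca -> L}) (pow : rat -> L)
    (D : {linear L -> L}) (r : nat) :
  pow 0 = 1 -> {morph pow : s t / s + t >-> s * t} -> pow 1 = iota (acoef 0) ->
  (forall u v, D (u * v) = D u * v + u * D v) ->
  (forall p, D (iota p) = iota (Eplus p)) ->
  (forall s, D (pow s) = (ratr (s * d%:R) : C) *: (pow (s - 1) * iota (acoef 1))) ->
  iota (h0 r) = pow (r.+1%:R - r%:R / d%:R) * iter r.+1 D (pow (r%:R / d%:R)).
Proof.
move=> pow0 powD pow1 DM Diota Dpow.
pose ev u := pow (pow_exp u) * iota (pow_coef u).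
have evE u : ev (Epow u) = D (ev u).
  case: u => s p; rewrite /ev /= DM Dpow Diota linearD linearZ_LR /= !rmorphM /=.
  rewrite mulrDr -scalerAr -scalerAl !mulrA; congr (_ + _ * _).
  by rewrite -pow1 -powD subrK.
have evI n u : ev (iter n Epow u) = iter n D (ev u).
  by elim: n => //= n <-; rewrite evE.
have ev1 s : ev (a0pow s) = pow s by rewrite /ev /= rmorph1 mulr1.
have -> : iota (h0 r) = ev (h0expr r) by rewrite /ev h0expr_exp pow0 mul1r.
rewrite -[in RHS](ev1 (r%:R / d%:R)) -evI -[in RHS]ev1.
by rewrite /ev /h0expr /= powD !rmorphM /= mulrACA.
Qed.

End Hform.

(* Main.v *)
From HB Require Import structures.
Require Import Defs.
From mathcomp Require Import all_boot all_order all_algebra.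
From mathcomp Require Import mpoly.
From mathcomp Require Import reals complex.
From mathcomp Require Import ring zify.

(* Dehomogenize by x_1 = 1, x_2 = x, and let f(x) = F(1, x).  Both sides are
   homogeneous of order N, so it suffices to compare dehomogenizations.

   The derivation E_+ - d/dx kills f and acts on the matrix defining the
   determinant as M |-> P M + M Q with P and Q of trace zero, so by Jacobi's
   formula it kills the determinant.  Hence the coefficients of both covariants
   are obtained from the constant one, the source, by applying E_+.

   The C_i dehomogenize to (r x^i f' - d (x^i)' f) / (r d), so the source is, up
   to a scalar for each column, the determinant of the coefficients of
   x^0, ..., x^r in r x^i f' - d (x^i)' f.  This is a Hessenberg matrix.  Since
   v = f^(r/d) satisfies r v f' - d v' f = 0, combining the rows with the
   coefficients of v truncated at degree r leaves only a multiple of the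
   coefficient of x^(r+1) in v, at position r.  As E_+ acts on f as d/dx, that
   coefficient is E_+^(r+1)(a_0^(r/d)) / (r+1)!. *)

Set Implicit Arguments.
Unset Strict Implicit.
Unset Printing Implicit Defensive.

Import GRing.Theory Num.Theory.
Local Open Scope ring_scope.

(** * Dehomogenization of binary forms *)

Section Dehomogenization.
Variable A : comNzRingType.
Implicit Types p q : {mpoly A[2]}.

Definition dehom p : {poly A} :=
  mmap (@polyC A) (fun i : 'I_2 => if i == ord0 then 1 else 'X) p.

HB.instance Definition _ := GRing.RMorphism.copy dehom
  (mmap (@polyC A) (fun i : 'I_2 => if i == ord0 then 1 else 'X)).

Lemma dehom_x1 : dehom x1 = 1.
Proof. by rewrite /dehom mmapX mmap1U eqxx. Qed.

Lemma dehom_x2 : dehom x2 = 'X.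
Proof. by rewrite /dehom mmapX mmap1U. Qed.

Lemma dehomZ c p : dehom (c *: p) = c *: dehom p.
Proof. by rewrite /dehom mmapZ mul_polyC. Qed.

Lemma dehom_monomial i j : dehom (x1 ^+ i * x2 ^+ j) = 'X^j.
Proof. by rewrite rmorphM /= !rmorphXn /= dehom_x1 dehom_x2 expr1n mul1r. Qed.

Lemma homog_monomial i j : (x1 ^+ i * x2 ^+ j : {mpoly A[2]}) \is (i + j).-homog.
Proof.
have h k (l : 'I_2) : ('X_l ^+ k : {mpoly A[2]}) \is k.-homog.
  by rewrite -{2}[k]mul1n; apply: dhomogMn; rewrite dhomogX; apply/eqP/mdeg1.
by apply: dhomogM; apply: h.
Qed.

Let mon i j : 'X_{1..2} := (U_(ord0) *+ i + U_(ord_max) *+ j)%MM.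

Let monE i j : (x1 ^+ i * x2 ^+ j : {mpoly A[2]}) = 'X_[mon i j].
Proof. by rewrite mpolyXD !mpolyXn. Qed.

Let eq_mon (m : 'X_{1..2}) : m = mon (m ord0) (m ord_max).
Proof.
apply/mnmP=> i; rewrite mnmDE !mulmnE !mnm1E.
case: i => [[|[|//]] lti].
  have -> : Ordinal lti = ord0 by apply: val_inj.
  by rewrite eqxx /= mul1n mul0n addn0.
have -> : Ordinal lti = ord_max by apply: val_inj.
by rewrite eqxx /= mul1n mul0n.
Qed.

Let homog_sum n p : p \is n.-homog ->
  p = \sum_(k < n.+1) p@_(mon (n - k) k) *: (x1 ^+ (n - k) * x2 ^+ k).
Proof.
move=> hp; apply/mpolyP=> m; rewrite raddf_sum /=.
under eq_bigr => k _ do rewrite mcoeffZ monE mcoeffX.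
have [dm|dm] := eqVneq (mdeg m) n; last first.
  rewrite (dhomog_nemf_coeff hp dm) big1 // => k _.
  case: eqP => [em|]; last by rewrite mulr0.
  by rewrite -em mdegD !mdegMn !mdeg1 !mul1n subnK ?eqxx -1?ltnS // in dm.
have dm2 : mdeg m = (m ord0 + m ord_max)%N.
  by rewrite {1}(eq_mon m) mdegD !mdegMn !mdeg1 !mul1n.
have lem : (m ord_max < n.+1)%N by lia.
rewrite (bigD1 (Ordinal lem)) //= big1 => [|k nk]; last first.
  case: eqP => [em|]; last by rewrite mulr0.
  case/eqP: nk; apply: val_inj => /=; rewrite -em.
  by rewrite mnmDE !mulmnE !mnm1E /= mul0n mul1n.
have -> : mon (n - m ord_max) (m ord_max) = m.
  by rewrite [RHS]eq_mon; congr mon; lia.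
by rewrite eqxx mulr1 addr0.
Qed.

(** Once the order is known nothing is lost at x_1 = 1; the final comparison is carried back to
    forms by this. *)
Lemma homog_dehomK n p : p \is n.-homog ->
  p = \sum_(k < n.+1) (dehom p)`_k *: (x1 ^+ (n - k) * x2 ^+ k).
Proof.
move=> hp; rewrite [LHS](homog_sum hp); apply: eq_bigr => k _; congr (_ *: _).
have -> : dehom p = \sum_(j < n.+1) p@_(mon (n - j) j) *: 'X^j.
  rewrite {1}(homog_sum hp) rmorph_sum /=.
  by apply: eq_bigr => j _; rewrite dehomZ dehom_monomial.
rewrite coef_sum (bigD1 k) //= big1 => [|j nj].
  by rewrite coefZ coefXn eqxx mulr1 addr0.
have /negPf nkj : (k : nat) != j by rewrite eq_sym.
by rewrite coefZ coefXn nkj mulr0.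
Qed.

Let dehomX m : dehom 'X_[m] = 'X^(m ord_max).
Proof.
by rewrite (eq_mon m) -monE dehom_monomial mnmDE !mulmnE !mnm1E mul0n mul1n.
Qed.

Lemma dehom_dx2 p : dehom (dx2 p) = (dehom p)^`().
Proof.
elim/mpolyind: p => [|c m p _ _ IHp]; first by rewrite /dx2 mderiv0 !raddf0.
rewrite /dx2 mderivD mderivZ !rmorphD /= derivD -/(dx2 p) IHp !dehomZ derivZ.
congr (_ *: _ + _).
by rewrite mderivX dehomZ !dehomX derivXn -scaler_nat mnmBE mnm1E subn1.
Qed.

(** Euler's identity n p = x_1 p_1 + x_2 p_2 at x_1 = 1, checked on monomials. *)
Lemma dehom_dx1 n p : p \is n.-homog ->
  dehom (dx1 p) = dehom p *+ n - 'X * (dehom p)^`().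
Proof.
move=> hp.
have -> : dx1 p = \sum_(m <- msupp p) p@_m *: ('X_[m])^`M(ord0).
  rewrite {1}(mpolyE p) /dx1 (raddf_sum (mderiv ord0)).
  by apply: eq_bigr => m _; rewrite /= mderivZ.
have -> : dehom p = \sum_(m <- msupp p) p@_m *: dehom 'X_[m].
  by rewrite {1}(mpolyE p) rmorph_sum; apply: eq_bigr => m _; rewrite /= dehomZ.
rewrite rmorph_sum raddf_sum /= -sumrMnl mulr_sumr -sumrB.
apply: eq_big_seq => m mp.
have dm : mdeg m = n := dhomog_mf hp mp.
have dm2 : n = (m ord0 + m ord_max)%N.
  by rewrite -dm mdegE big_ord_recl big_ord1; congr (_ + m _)%N; apply: val_inj.
rewrite mderivX !dehomZ !dehomX mnmBE mnm1E subn0 derivZ derivXn.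
rewrite -scalerAr scalerMnr -scalerBr; congr (_ *: _).
rewrite dm2 mulrnDr -scaler_nat mulrnAr -exprS.
(* When [m ord_max] is 0 the truncated predecessor gives a wrong exponent, but the term has
   multiplicity 0. *)
by case: (m ord_max) => [|k]; rewrite ?mulr0n ?subr0 ?addr0 // addrK.
Qed.

Lemma homog_mderiv n (i : 'I_2) p : p \is n.-homog -> p^`M(i) \is n.-1.-homog.
Proof.
move=> hp; apply/dhomogP => m; rewrite mcoeff_msupp mcoeff_mderiv => h.
have [<-|dm] := eqVneq (mdeg (m + U_(i))%MM) n; first by rewrite mdegD mdeg1 addn1.
by rewrite (dhomog_nemf_coeff hp dm) mul0rn eqxx in h.
Qed.

End Dehomogenization.

(** * Jacobi's formula for an abstract derivation *)

Section DerivationDeterminant.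
Variables (B : comNzRingType) (D : {additive B -> B}).
Hypothesis DM : forall a b, D (a * b) = D a * b + a * D b.

Lemma derivation1 : D 1 = 0.
Proof. by apply: (addIr (D 1)); rewrite add0r -{3}[1]mulr1 DM mulr1 mul1r. Qed.

Lemma derivation_prod (I : eqType) (s : seq I) (F : I -> B) : uniq s ->
  D (\prod_(i <- s) F i)
  = \sum_(k <- s) D (F k) * \prod_(i <- s | i != k) F i.
Proof.
elim: s => [|a s IHs] /=; first by rewrite !big_nil derivation1.
case/andP=> nas us; rewrite !big_cons eqxx /= DM IHs //; congr (_ * _ + _).
  rewrite big_seq [RHS]big_seq_cond; apply: eq_bigl => i.
  by case: eqP => [->|]; rewrite ?andbT // (negPf nas).
rewrite mulr_sumr; apply: eq_big_seq => k sk; rewrite big_cons.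
by case: eqP sk nas => [<- ->//|_ _ _]; rewrite mulrCA.
Qed.

(** Both sides are the sum over k of the determinants of M with D applied to row k only: the trace
    by Laplace expansion along that row, D (det M) by the product rule in each permutation term. *)
Lemma derivation_det n (M : 'M[B]_n) : D (\det M) = \tr (map_mx D M *m \adj M).
Proof.
pose N k := \matrix_(i, j) (if i == k then D (M i j) else M i j).
have -> : \tr (map_mx D M *m \adj M) = \sum_k \det (N k).
  apply: eq_bigr => k _; rewrite mxE (expand_det_row _ k); apply: eq_bigr => j _.
  rewrite !mxE eqxx; congr (_ * (_ * \det _)).
  by apply/matrixP=> a b; rewrite !mxE eq_sym (negPf (neq_lift _ _)).
rewrite raddf_sum exchange_big; apply: eq_bigr => s _.
rewrite -mulr_sumr -signr_odd.
have Dsign (b : bool) a : D ((-1) ^+ b * a) = (-1) ^+ b * D a.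
  by case: b; rewrite ?mul1r // !mulN1r raddfN.
rewrite Dsign derivation_prod ?index_enum_uniq //; congr (_ * _).
apply: eq_bigr => k _; rewrite [RHS](bigD1 k) //= mxE eqxx; congr (_ * _).
by apply: eq_bigr => i /negPf ik; rewrite mxE ik.
Qed.

(** Jacobi's formula and cyclicity of the trace give D (det M) = (tr P + tr Q) det M. *)
Lemma derivation_det0 n (M P Q : 'M[B]_n) :
  map_mx D M = P *m M + M *m Q -> \tr P = 0 -> \tr Q = 0 -> D (\det M) = 0.
Proof.
move=> DE trP trQ; rewrite derivation_det DE mulmxDl mxtraceD -mulmxA mul_mx_adj.
rewrite [\tr (M *m Q *m _)]mxtrace_mulC mulmxA mul_adj_mx mul_scalar_mx mul_mx_scalar !mxtraceZ.
by rewrite trP trQ !mulr0 addr0.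
Qed.

End DerivationDeterminant.

(** * The dehomogenized determinant is annihilated by E_+ - d/dx *)

Section CovariantDeterminant.
Variables (A : comNzRingType) (E : {additive A -> A}).
Hypothesis EM : forall a b, E (a * b) = E a * b + a * E b.

(* The dehomogenization of E_+ - x_1 d/dx_2, which annihilates covariants. *)
Definition sl2_raise (q : {poly A}) := map_poly E q - q^`().

Lemma sl2_raise_is_zmod_morphism : zmod_morphism sl2_raise.
Proof. by move=> p q; rewrite /sl2_raise raddfB derivB; ring. Qed.

HB.instance Definition _ :=
  GRing.isZmodMorphism.Build {poly A} {poly A} sl2_raise sl2_raise_is_zmod_morphism.

Lemma map_poly_derivationM p q :
  map_poly E (p * q) = map_poly E p * q + p * map_poly E q.
Proof.
apply/polyP=> k; rewrite coefD coef_map !coefM raddf_sum -big_split /=.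
by apply: eq_bigr => i _; rewrite EM !coef_map.
Qed.

Lemma sl2_raiseM p q : sl2_raise (p * q) = sl2_raise p * q + p * sl2_raise q.
Proof. by rewrite /sl2_raise map_poly_derivationM derivM; ring. Qed.

Lemma sl2_raiseX : sl2_raise 'X = -1.
Proof.
rewrite /sl2_raise derivX; have -> : map_poly E 'X = 0; last by rewrite sub0r.
apply/polyP=> k; rewrite coef_map coefX coef0 /=.
by case: (k == 1%N); rewrite ?raddf0 // (derivation1 EM).
Qed.

Lemma sl2_raise_deriv q : sl2_raise q^`() = (sl2_raise q)^`().
Proof.
rewrite /sl2_raise derivB; congr (_ - _).
by apply/polyP=> k; rewrite coef_map !coef_deriv coef_map raddfMn.
Qed.

Lemma sl2_raise_derivn j q : sl2_raise q^`(j) = (sl2_raise q)^`(j).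
Proof. by elim: j => // j IHj; rewrite !derivnS sl2_raise_deriv IHj. Qed.

(* The dehomogenization of d_1^m d_2^j p when p is homogeneous of degree n
   with dehomogenization q; Euler's identity turns d_1 into deg - x d/dx. *)
Fixpoint mixed_deriv n m j (q : {poly A}) : {poly A} :=
  if m is m'.+1 then
    mixed_deriv n m' j q *+ (n - m' - j) - 'X * mixed_deriv n m' j.+1 q
  else q^`(j).

Lemma mixed_deriv_is_zmod_morphism n m j : zmod_morphism (mixed_deriv n m j).
Proof.
move=> p q; elim: m j => [|m IHm] j /=; first by rewrite derivnB.
by rewrite !IHm mulrnBl; ring.
Qed.

HB.instance Definition _ n m j := GRing.isZmodMorphism.Build {poly A} {poly A}
  (mixed_deriv n m j) (@mixed_deriv_is_zmod_morphism n m j).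

(** The commutator of E_+ - x_1 d_2 with d_1 is d_2, and with d_2 it is 0; so each of the m factors
    d_1 is replaced in turn by d_2. *)
Lemma sl2_raise_mixed_deriv n m j q :
  sl2_raise (mixed_deriv n m j q) =
  mixed_deriv n m j (sl2_raise q) + mixed_deriv n m.-1 j.+1 q *+ m.
Proof.
elim: m j => [|m IHm] j; first by rewrite /= sl2_raise_derivn addr0.
rewrite [mixed_deriv _ _.+1 _ q]/= [mixed_deriv _ _.+1 _ (sl2_raise q)]/=.
rewrite raddfB raddfMn /= sl2_raiseM sl2_raiseX !IHm.
case: m IHm => [|m] IHm; rewrite /=; first by rewrite !addr0; ring.
rewrite (_ : n - m - j.+1 = n - m.+1 - j)%N; last by lia.
set a := (n - m.+1 - j)%N; set b := (n - m - j)%N; ring.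
Qed.

Variables (r d : nat) (s : A) (f : {poly A}).
Hypotheses (Es : E s = 0) (Df : sl2_raise f = 0).

Definition dehom_transvectant (i : nat) : {poly A} :=
  s *: ('X^i * f^`() *+ r - ('X^i)^`() * f *+ d).

(** The number r + d - 2 is the order of the transvectants C_i. *)
Definition covariant_mx : 'M[{poly A}]_r.+1 := \matrix_(i, j)
  mixed_deriv (r + d - 2) (r - j) j (dehom_transvectant i).

Lemma sl2_raiseZ q : sl2_raise (s *: q) = s *: sl2_raise q.
Proof.
rewrite /sl2_raise derivZ scalerBr; congr (_ - _).
by apply/polyP=> k; rewrite coef_map !coefZ coef_map /= EM Es mul0r add0r.
Qed.

Lemma sl2_raiseXn i : sl2_raise 'X^i = - ('X^(i.-1) *+ i).
Proof.
rewrite /sl2_raise derivXn (_ : map_poly E 'X^i = 0) ?sub0r //.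
apply/polyP=> k; rewrite coef_map coefXn coef0 /=.
by case: (k == i); rewrite ?raddf0 // (derivation1 EM).
Qed.

(** By equivariance of the transvectant, and since f is annihilated, the operator acts on the
    monomial ['X^i] alone. *)
Lemma sl2_raise_transvectant i :
  sl2_raise (dehom_transvectant i) = - (dehom_transvectant i.-1 *+ i).
Proof.
rewrite sl2_raiseZ scalerMnr -scalerN; congr (_ *: _).
rewrite raddfB !raddfMn /= !sl2_raiseM !sl2_raise_deriv Df deriv0.
rewrite sl2_raiseXn derivN derivMn; ring.
Qed.

(** The action on the transvectants shifts rows (P), the commutator with the mixed derivatives
    shifts columns (Q). Both shift matrices have zero diagonal. *)
Lemma sl2_raise_covariant : sl2_raise (\det covariant_mx) = 0.
Proof.
pose P : 'M[{poly A}]_r.+1 := \matrix_(i, j) (- ((i == j.+1 :> nat)%:R *+ i)).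
pose Q : 'M[{poly A}]_r.+1 := \matrix_(i, j) ((i == j.+1 :> nat)%:R *+ (r - j)).
apply: (derivation_det0 sl2_raiseM (P := P) (Q := Q)).
- apply/matrixP=> i j; rewrite !mxE /= sl2_raise_mixed_deriv sl2_raise_transvectant.
  rewrite raddfN raddfMn /=; congr (_ + _).
    under eq_bigr => k _ do rewrite !mxE.
    case: (posnP i) => [i0|i_gt0].
      by rewrite i0 mulr0n oppr0 big1 // => k _; rewrite mul0r.
    have lti : (i.-1 < r.+1)%N by have := ltn_ord i; lia.
    rewrite (bigD1 (Ordinal lti)) //= big1 => [|k nk].
      by rewrite prednK // eqxx addr0 mulNr mulrnAl mul1r.
    rewrite (_ : (i == k.+1 :> nat) = false) ?mul0rn ?oppr0 ?mul0r //.
    by apply: contraNF nk => /eqP ik; apply/eqP/val_inj => /=; lia.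
  under eq_bigr => k _ do rewrite !mxE.
  (* The last column has no successor, but its coefficient r - j is 0. *)
  case: (ltnP j r) => ltj; last first.
    have -> : (r - j = 0)%N by lia.
    by rewrite mulr0n big1 // => k _; rewrite mulr0n mulr0.
  have ltj1 : (j.+1 < r.+1)%N by [].
  rewrite (bigD1 (Ordinal ltj1)) //= big1 => [|k nk].
    by rewrite eqxx addr0 mulrnAr mulr1 -subnS.
  rewrite (_ : (k == j.+1 :> nat) = false) ?mul0rn ?mulr0 //.
  by apply: contraNF nk => /eqP ik; apply/eqP/val_inj.
- by rewrite /mxtrace big1 // => k _; rewrite mxE ltn_eqF // mul0rn oppr0.
by rewrite /mxtrace big1 // => k _; rewrite mxE ltn_eqF // mul0rn.
Qed.

End CovariantDeterminant.

(** * The source as a Hessenberg determinant *)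

Section SourceDeterminant.
Variables (A : idomainType) (E : {additive A -> A}).
Hypothesis EM : forall a b, E (a * b) = E a * b + a * E b.
Hypothesis A_pchar0 : forall n, n.+1%:R != 0 :> A.
Variables (r d : nat) (phi : nat -> A) (a1 : A).
Hypothesis Ephi : forall m, E (phi m) = phi m.+1 *+ m.+1.
Hypothesis phi1E : phi 1 = a1 *+ d.

Let a0 := phi 0.
(** This is E^m(a_0). *)
Let b m := phi m *+ m`!.

(* a_0^(r/d - k - 1) (weighted_raise k q) is E (a_0^(r/d - k) q). *)
Definition weighted_raise k q := (r%:R - (k * d)%:R) * (a1 * q) + a0 * E q.

(** This encodes a_0^(k-r/d) E^k(a_0^(r/d)) without fractional powers. *)
Fixpoint power_deriv k :=
  if k is k'.+1 then weighted_raise k' (power_deriv k') else 1.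

Let p := power_deriv.

Lemma weighted_raise_is_zmod_morphism k : zmod_morphism (weighted_raise k).
Proof. by move=> x y; rewrite /weighted_raise raddfB; ring. Qed.

HB.instance Definition _ k := GRing.isZmodMorphism.Build A A
  (weighted_raise k) (@weighted_raise_is_zmod_morphism k).

Let Eb m : E (b m) = b m.+1.
Proof. by rewrite /b raddfMn /= Ephi -mulrnA -factS. Qed.

Let Ea0X m : E (a0 ^+ m.+1) = a0 ^+ m * a1 *+ (m.+1 * d).
Proof.
elim: m => [|m IHm]; first by rewrite expr1 Ephi expr0 mul1r phi1E mul1n mulr1n.
rewrite exprS EM IHm Ephi phi1E mulr1n !exprS; ring.
Qed.

(** For v = a_0^(r/d), the term [b m * a0 ^+ m * p i] is a_0^(m+i-r/d) E^m(a_0) E^i(v), so this is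
    the product rule for E^m(a_0) E^i(v). *)
Lemma weighted_raise_term m i :
  weighted_raise (m + i) (b m * a0 ^+ m * p i)
  = b m.+1 * a0 ^+ m.+1 * p i + b m * a0 ^+ m * p i.+1.
Proof.
rewrite /p /= -/p /weighted_raise !EM Eb.
case: m => [|m]; first by rewrite !expr0 (derivation1 EM) add0n expr1; ring.
by rewrite Ea0X !exprS; ring.
Qed.

(** The induction step of the higher Leibniz formula, by Pascal's rule. The product rule is assumed
    only in total order j because [weighted_raise k] obeys it in a single weight. *)
Lemma pascal_step (L : {additive A -> A}) (t : nat -> nat -> A) j :
  (forall i, (i <= j)%N -> L (t (j - i)%N i) = t (j - i)%N.+1 i + t (j - i)%N i.+1) ->
  L (\sum_(i < j.+1) t (j - i)%N i *+ 'C(j, i))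
  = \sum_(i < j.+2) t (j.+1 - i)%N i *+ 'C(j.+1, i).
Proof.
move=> Lt; rewrite raddf_sum /=.
under eq_bigr => i _ do rewrite raddfMn /= Lt -1?ltnS // mulrnDl.
rewrite big_split /= [RHS]big_ord_recl /= bin0.
under [in RHS]eq_bigr => i _ do rewrite /bump add1n binS mulrnDr.
rewrite big_split /= addrA; congr (_ + _).
rewrite [in RHS]big_ord_recr /= bin_small // mulr0n addr0.
rewrite big_ord_recl /= bin0 !subn0; congr (_ + _).
by apply: eq_bigr => i _; rewrite /bump add1n subnSK // subSS.
Qed.

(* The j-th derivative of r E(a_0) v = d a_0 E(v), where v = a_0^(r/d), expanded
   by the Leibniz rule and cleared of its fractional power of a_0. *)
Lemma power_deriv_relation j :
  (\sum_(i < j.+1) b (j - i).+1 * a0 ^+ (j - i).+1 * p i *+ 'C(j, i)) *+ r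
  = (\sum_(i < j.+1) b (j - i) * a0 ^+ (j - i) * p i.+1 *+ 'C(j, i)) *+ d.
Proof.
elim: j => [|j IHj].
  rewrite !big_ord1 /p /= /weighted_raise (derivation1 EM) /b /= phi1E /a0; ring.
(* All terms of the relation at j have weight j + 1, so applying [weighted_raise j.+1] to it yields
   the relation at j + 1. *)
rewrite -(@pascal_step (weighted_raise j.+1) (fun m i => b m.+1 * a0 ^+ m.+1 * p i)).
  rewrite -(@pascal_step (weighted_raise j.+1) (fun m i => b m * a0 ^+ m * p i.+1)).
    by rewrite -raddfMn IHj raddfMn.
  move=> i lij; rewrite -weighted_raise_term.
  by congr weighted_raise; lia.
move=> i lij; rewrite -weighted_raise_term.
by congr weighted_raise; lia.
Qed.

(* The coefficient of x^j in r x^i f' - d (x^i)' f, where f = \sum_k phi_k x^k. *)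
Definition source_mx : 'M[A]_r.+1 := \matrix_(i, j)
  ((if (i <= j)%N then phi (j - i).+1 *+ (r * (j - i).+1) else 0)
   - (if (i <= j.+1)%N then phi (j.+1 - i) *+ (d * i) else 0)).

(* Up to the common factor r! a_0^(r+1-r/d), the coefficient of x^i in f^(r/d),
   so that combE truncates r v f' - d v' f = 0 for v = f^(r/d). *)
Let y i := a0 ^+ (r.+1 - i) * p i *+ r ^_ (r - i).

Let ffact_bin i j : (i <= j <= r)%N ->
  (r ^_ (r - i) = r ^_ (r - j) * 'C(j, i) * (j - i)`!)%N.
Proof.
case/andP=> lij ljr; apply/eqP; rewrite -(eqn_pmul2r (fact_gt0 i)).
have := ffact_fact (leq_subr i r); rewrite subKn ?(leq_trans lij) // => ->.
have := ffact_fact (leq_subr j r); rewrite subKn // => <-.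
by rewrite -(bin_fact lij); apply/eqP; lia.
Qed.

Let sum_narrow (F : nat -> A) n m : (n <= m)%N ->
  \sum_(i < m) (if (i < n)%N then F i else 0) = \sum_(i < n) F i.
Proof. by move=> lenm; rewrite -big_mkcond (big_ord_widen _ F lenm). Qed.

Let combE (j : 'I_r.+1) :
  \sum_(i < r.+1) y i * source_mx i j
  = if j == ord_max then a0 * p r.+1 *+ d else 0.
Proof.
have ljr : (j <= r)%N by rewrite -ltnS.
under eq_bigr => i _ do rewrite mxE mulrBr.
rewrite sumrB.
(* By r!/i! = (r!/j!) C(j,i) (j-i)!, column j of the combination is [c] times the difference of the
   sides of [power_deriv_relation j], up to truncation. *)
pose c := a0 ^+ (r - j) *+ r ^_ (r - j).
have -> : \sum_(i < r.+1) y i *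
      (if (i <= j)%N then phi (j - i).+1 *+ (r * (j - i).+1) else 0)
    = (\sum_(i < j.+1) b (j - i).+1 * a0 ^+ (j - i).+1 * p i *+ 'C(j, i)) *+ r * c.
  rewrite -sumrMnl mulr_suml -(sum_narrow (fun i => b (j - i).+1 * a0 ^+ (j - i).+1 * p i *+ 'C(j, i) *+ r * c)
    (ltn_ord j)).
  apply: eq_bigr => i _; rewrite ltnS; case: leqP => [lij|_]; last by rewrite mulr0.
  rewrite /y /b /c (ffact_bin (i := i) (j := j)) ?lij // factS.
  have -> : (r.+1 - i = (j - i).+1 + (r - j))%N by lia.
  by rewrite exprD; ring.
have -> : \sum_(i < r.+1) y i *
      (if (i <= j.+1)%N then phi (j.+1 - i) *+ (d * i) else 0)
    = \sum_(i < r) (if (i < j.+1)%N then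
        b (j - i) * a0 ^+ (j - i) * p i.+1 *+ 'C(j, i) *+ d * c else 0).
  rewrite big_ord_recl /= muln0 mulr0n mulr0 add0r.
  apply: eq_bigr => i _; rewrite /bump add1n ltnS.
  case: leqP => [lij|_]; last by rewrite mulr0.
  have e : (r ^_ (r - i) = r ^_ (r - i.+1) * i.+1)%N.
    by rewrite -subnSK // ffactnSr subKn.
  have := ffact_bin (i := i) (j := j); rewrite lij e => /(_ ljr) {}e.
  rewrite /y /b /c subSS.
  have -> : (r - i = (j - i) + (r - j))%N by lia.
  have -> : a0 ^+ (j - i + (r - j)) * p i.+1 *+ r ^_ (r - i.+1) *
            (phi (j - i) *+ (d * i.+1))
     = a0 ^+ (j - i) * a0 ^+ (r - j) * p i.+1 * phi (j - i) *+ d *+ (r ^_ (r - i.+1) * i.+1).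
    by rewrite exprD; ring.
  by rewrite e; ring.
(* For j < r both sums are complete and cancel. At j = r the second sum lacks its last term, which
   involves [p r.+1]; that term is what remains. *)
rewrite power_deriv_relation; case: eqP => [j_r|/eqP j_neq].
  have ejr : nat_of_ord j = r by rewrite j_r.
  rewrite /c ejr subnn expr0 ffactn0 mulr1n mulr1.
  rewrite big_ord_recr /= subnn binn mulr1n expr0 mulr1 mulrnDl -sumrMnl.
  under [X in _ - X]eq_bigr => i _ do rewrite ltnS (ltnW (ltn_ord i)) mulr1.
  by rewrite addrC addKr /b fact0 mulr1n.
have ltjr : (j < r)%N.
  by rewrite ltn_neqAle ljr andbT; apply: contraNneq j_neq => e; apply/eqP/val_inj.
rewrite (sum_narrow (fun i => b (j - i) * a0 ^+ (j - i) * p i.+1 *+ 'C(j, i) *+ d * c)) //.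
by rewrite -mulr_suml sumrMnl subrr.
Qed.

(** Y replaces row 0 by the combination of [combE], whose only nonzero entry can be the last.
    Without row 0 and the last column the Hessenberg matrix is triangular with diagonal -d a_0
    (i+1). Finally det Y = r! a_0^(r+1) is cancelled. *)
Lemma det_source_mx : phi 0 != 0 -> \det source_mx = p r.+1 *+ d ^ r.+1.
Proof.
move=> a0_neq0.
pose Y : 'M[A]_r.+1 := \matrix_(i, j) if i == ord0 then y j else (i == j)%:R.
have detY : \det Y = a0 ^+ r.+1 *+ r`!.
  rewrite -det_tr det_trig; last first.
    apply/is_trig_mxP=> i j ltij; rewrite !mxE.
    by rewrite -!val_eqE /= !gtn_eqF // (leq_ltn_trans _ ltij).
  rewrite big_ord_recl big1 => [|i _]; rewrite !mxE /= ?eqxx //.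
  by rewrite /y !subn0 ffactnn mulr1 /p /= mulr1.
have YK i j : (Y *m source_mx) i j =
    if i == ord0 then (if j == ord_max then a0 * p r.+1 *+ d else 0)
    else source_mx i j.
  rewrite [LHS]mxE; under eq_bigr => k _ do rewrite [Y _ _]mxE.
  have [_|ni] := eqVneq i ord0; first by rewrite -combE.
  rewrite (bigD1 i) //= eqxx mul1r big1 ?addr0 // => k /negPf nki.
  by rewrite eq_sym nki mul0r.
have detYK : \det (Y *m source_mx) = a0 ^+ r.+1 * p r.+1 *+ (d ^ r.+1 * r`!).
  rewrite (expand_det_row _ ord0) (bigD1 ord_max) //= big1 => [|j /negPf nj]; last first.
    by rewrite YK nj mul0r.
  rewrite addr0 YK !eqxx /cofactor -det_tr det_trig; last first.
    apply/is_trig_mxP=> i j ltij; rewrite 3![LHS]mxE [LHS]YK /= mxE.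
    rewrite lift_max /= /bump add1n /=.
    by rewrite !ltnS ltnNge (ltnW ltij) /= leqNgt ltij subrr.
  have -> : \prod_(i < r) (row' ord0 (col' ord_max (Y *m source_mx)))^T i i
          = \prod_(i < r) (- a0 * d%:R * i.+1%:R).
    apply: eq_bigr => i _; rewrite 3![LHS]mxE [LHS]YK /= mxE lift_max /= /bump add1n /=.
    rewrite ltnn leqnn subnn sub0r /a0; ring.
  have factE : \prod_(i < r) (i.+1%:R : A) = r`!%:R.
    elim: (r) => [|n IHn]; first by rewrite big_ord0.
    by rewrite big_ord_recr /= IHn factS natrM mulrC.
  rewrite big_split /= prodr_const card_ord factE add0n.
  (* The r signs of the diagonal cancel the cofactor sign (-1)^r. *)
  rewrite mulNr (exprNn (a0 * d%:R)) -[X in (-1) ^+ r * X]mulrA [(-1) ^+ r * (_ * _)]mulrA.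
  rewrite -expr2 sqrr_sign mul1r exprMn.
  rewrite exprS expnS -[in RHS]mulr_natr !natrM natrX; ring.
apply: (mulfI (x := r`!%:R * a0 ^+ r.+1)).
  rewrite mulf_neq0 ?expf_neq0 //.
  by case: (r`!) (fact_gt0 r).
rewrite det_mulmx detY in detYK.
by rewrite mulr_natl detYK mulrnA mulrnAl mulrnAr.
Qed.

End SourceDeterminant.

(** * Homogeneity and dehomogenization of the determinant's entries *)

Section DehomogenizedMixedDerivatives.
Variable A : comNzRingType.
Implicit Types p q : {mpoly A[2]}.

Lemma homog_iter_mderiv n (i : 'I_2) k p :
  p \is n.-homog -> iter k (mderiv i) p \is (n - k).-homog.
Proof.
move=> hp; elim: k => [|k IHk] /=; first by rewrite subn0.
by rewrite subnS; apply: homog_mderiv.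
Qed.

Lemma dehom_mixed_deriv n m j p : p \is n.-homog ->
  dehom (iter m (@dx1 A) (iter j (@dx2 A) p)) = mixed_deriv n m j (dehom p).
Proof.
move=> hp; elim: m j => [|m IHm] j /=.
  by elim: j => //= j IHj; rewrite dehom_dx2 IHj.
rewrite (@dehom_dx1 _ (n - m - j)); last first.
  by rewrite subnAC; do 2 apply: homog_iter_mderiv.
rewrite -dehom_dx2 -!IHm /=; congr (_ - 'X * dehom _).
elim: m {IHm} => //= m IHm.
by rewrite -IHm; exact: mderiv_comm.
Qed.

(** After Euler's identity for each d_1, the two products x p' q' cancel. *)
Lemma dehom_jacobian m n p q : p \is m.-homog -> q \is n.-homog ->
  dehom (dx1 p * dx2 q - dx2 p * dx1 q)
  = dehom p * (dehom q)^`() *+ m - (dehom p)^`() * dehom q *+ n.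
Proof.
move=> hp hq; rewrite rmorphB /= rmorphM /= rmorphM /=.
rewrite dehom_dx2 dehom_dx2 (dehom_dx1 hp) (dehom_dx1 hq).
move: (dehom p) (dehom q) => u v; ring.
Qed.

Lemma homog_prod_const n e (F : 'I_n -> {mpoly A[2]}) :
  (forall i, F i \is e.-homog) -> \prod_(i < n) F i \is (n * e).-homog.
Proof.
elim: n F => [|n IHn] F hF; first by rewrite big_ord0 dhomog1.
by rewrite big_ord_recl mulSn; apply: dhomogM => //; apply: IHn.
Qed.

Lemma homog_det n e (M : 'M[{mpoly A[2]}]_n) :
  (forall i j, M i j \is e.-homog) -> \det M \is (n * e).-homog.
Proof.
move=> hM; apply: rpred_sum => s _; rewrite mulr_sign.
by case: ifP => _; rewrite ?rpredN homog_prod_const.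
Qed.

(** At x = 0 only the degree factors of Euler's identity survive, and they multiply to a falling
    factorial. *)
Lemma coef0_mixed_deriv n m j (q : {poly A}) :
  (mixed_deriv n m j q)`_0 = q`_j *+ (j`! * (n - j) ^_ m).
Proof.
elim: m j => [|m IHm] j /=; first by rewrite coef_derivn addn0 ffactnn muln1.
by rewrite coefB coefMn coefXM /= subr0 IHm -mulrnA ffactnSr mulnA subnAC.
Qed.

End DehomogenizedMixedDerivatives.

(** * The generic form and the comparison of sources *)

Section GenericForm.
Variables (C : numFieldType) (d : nat).
Hypothesis d_ge2 : (2 <= d)%N.
Local Notation Ca := {mpoly C[d.+1]}.
Local Notation Eplus := (@Eplus C d).
Local Notation a := (@acoef C d).

Lemma Eplus_is_linear : linear Eplus.
Proof.
move=> c p q; rewrite /Defs.Eplus scaler_sumr -big_split; apply: eq_bigr => i _ /=.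
by rewrite mderivD mderivZ mulrDr mulrnDl -scalerAr scalerMnr.
Qed.

HB.instance Definition _ := GRing.isLinear.Build C Ca Ca _ Eplus Eplus_is_linear.

Lemma EplusM p q : Eplus (p * q) = Eplus p * q + p * Eplus q.
Proof.
rewrite /Defs.Eplus mulr_suml mulr_sumr -big_split; apply: eq_bigr => i _ /=.
by rewrite mderivM; ring.
Qed.

Lemma Eplus_acoef i : (i <= d)%N -> Eplus (a i) = a i.+1 *+ (d - i).
Proof.
move=> lid; rewrite /Defs.Eplus.
have dX (k : 'I_d) : (a i)^`M(inord k) = (i == k)%:R.
  rewrite /acoef mderivX mnm1E.
  have -> : (inord i == inord k :> 'I_d.+1) = (i == k).
    by rewrite -val_eqE /= !inordK // ltnS ltnW.
  case: eqP => [->|_]; last by rewrite scale0r.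
  rewrite (_ : (_ - _)%MM = 0%MM) ?mpolyX0 ?scale1r //.
  by apply/mnmP=> l; rewrite mnmBE mnm0E subnn.
have [ltid|ledi] := ltnP i d.
  rewrite (bigD1 (Ordinal ltid)) // dX eqxx mulr1 big1 => [|k nk]; first by rewrite /= addr0.
  by rewrite dX eq_sym (negPf (_ : (k : nat) != i)) ?mulr0 ?mul0rn.
have e : i = d by apply/eqP; rewrite eqn_leq lid.
(* Here i = d, and the out-of-range [a d.+1] is multiplied by 0. *)
have -> : (d - i = 0)%N by rewrite e subnn.
by rewrite mulr0n big1 // => k _; rewrite dX e gtn_eqF // mulr0 mul0rn.
Qed.

(** For k > d the binomial vanishes, which extends the coefficients by 0 beyond the range of [a]. *)
Let phi k : Ca := a k *+ 'C(d, k).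

Lemma Eplus_phi k : Eplus (phi k) = phi k.+1 *+ k.+1.
Proof.
rewrite /phi; have [lkd|ltdk] := leqP k d; last first.
  by rewrite (bin_small ltdk) (bin_small (leqW ltdk)) !mulr0n mul0rn raddf0.
by rewrite raddfMn /= Eplus_acoef // -!mulrnA -mul_bin_left mulnC.
Qed.

Lemma coef_dehom_generic_form k : (dehom (generic_form C d))`_k = phi k.
Proof.
rewrite rmorph_sum /=; under eq_bigr => i _ do rewrite dehomZ dehom_monomial.
rewrite coef_sum; have [ltkd|ledk] := ltnP k d.+1.
  rewrite (bigD1 (Ordinal ltkd)) //= coefZ coefXn eqxx mulr1 big1 ?addr0 // => i ni.
  by rewrite coefZ coefXn eq_sym -val_eqE in ni *; rewrite (negPf ni) mulr0.
rewrite /phi bin_small // mulr0n big1 // => i _.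
by rewrite coefZ coefXn gtn_eqF ?mulr0 // (leq_trans (ltn_ord i)).
Qed.

Lemma homog_generic_form : generic_form C d \is d.-homog.
Proof.
apply: rpred_sum => i _; apply: dhomogZ.
by have := homog_monomial Ca (d - i) i; rewrite subnK // -ltnS.
Qed.

Lemma sl2_raise_generic_form : sl2_raise Eplus (dehom (generic_form C d)) = 0.
Proof.
apply/polyP=> k; rewrite coefB coef_map coef_deriv !coef_dehom_generic_form /=.
by rewrite Eplus_phi subrr coef0.
Qed.

Variable r : nat.
Hypothesis r_ge1 : (1 <= r)%N.

Let s : Ca := ((r * d)%:R^-1 : C)%:A.
Let A_ i : {mpoly Ca[2]} := x1 ^+ (r - i) * x2 ^+ i.

Lemma homog_transvectant i : (i <= r)%N ->
  transvectant1 (C := C) r d (A_ i) (generic_form C d) \is (r + d - 2).-homog.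
Proof.
move=> lir; apply: dhomogZ.
have hA : A_ i \is r.-homog by have := homog_monomial Ca (r - i) i; rewrite subnK.
have -> : (r + d - 2 = r.-1 + d.-1)%N by lia.
by apply: rpredB; apply: dhomogM; apply: homog_mderiv => //; apply: homog_generic_form.
Qed.

Lemma dehom_transvectant1 i : (i <= r)%N ->
  dehom (transvectant1 (C := C) r d (A_ i) (generic_form C d))
  = dehom_transvectant r d s (dehom (generic_form C d)) i.
Proof.
move=> lir; rewrite /transvectant1 dehomZ; congr (_ *: _).
have hA : A_ i \is r.-homog by have := homog_monomial Ca (r - i) i; rewrite subnK.
rewrite (dehom_jacobian hA homog_generic_form).
by rewrite (_ : dehom (A_ i) = 'X^i) //; apply: dehom_monomial.
Qed.

Lemma dehom_Gform : dehom (Gform (C := C) r d (generic_form C d))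
  = \det (covariant_mx r d s (dehom (generic_form C d))).
Proof.
rewrite -det_map_mx; congr (\det _); apply/matrixP=> i j; rewrite !mxE.
have lir : (i <= r)%N by rewrite -ltnS.
by rewrite -dehom_transvectant1 //; apply: dehom_mixed_deriv; apply: homog_transvectant.
Qed.

Lemma homog_Gform : Gform (C := C) r d (generic_form C d) \is (orderN d r).-homog.
Proof.
apply: homog_det => i j; rewrite mxE.
have -> : (d - 2 = r + d - 2 - j - (r - j))%N by have := ltn_ord j; lia.
by do 2 apply: homog_iter_mderiv; apply: homog_transvectant; rewrite -ltnS.
Qed.

(** The rational factor (r/d - k) d of the derivation rule is the integer r - k d of
    [weighted_raise]. *)
Lemma power_deriv_Epow k : iter k (@Epow C d) (a0pow C d (r%:R / d%:R))
  = PowExpr (r%:R / d%:R - k%:R) (power_deriv Eplus r d phi (a 1) k).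
Proof.
elim: k => [|k IHk]; first by rewrite subr0.
rewrite iterS IHk /Epow /= -addrA -opprD natr1; congr PowExpr.
rewrite /weighted_raise /phi bin0 mulr1n; congr (_ + _).
have d_neq0 : d%:R != 0 :> rat by rewrite pnatr_eq0; lia.
have -> : ratr ((r%:R / d%:R - k%:R) * d%:R) = r%:R - (k * d)%:R :> C.
  by rewrite mulrBl divfK // -natrM rmorphB /= !ratr_nat.
by rewrite scalerBl !scaler_nat mulrBl !mulr_natl.
Qed.

Lemma h0_power_deriv : h0 C d r = power_deriv Eplus r d phi (a 1) r.+1.
Proof. by rewrite /h0 /h0expr power_deriv_Epow /mulpow /= mul1r. Qed.

(** Factor j collects the constant of [coef0_mixed_deriv] in column j and the transvectant's 1/(r
    d); the power of d comes from [det_source_mx]. *)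
Definition kappa : rat :=
  (\prod_(j < r.+1) ((j`! * (r + d - 2 - j) ^_ (r - j))%:R / (r * d)%:R)) * (d ^ r.+1)%:R.

Lemma kappa_neq0 : kappa != 0.
Proof.
rewrite /kappa mulf_neq0 //; last by rewrite pnatr_eq0 expn_eq0; lia.
rewrite prodf_seq_neq0; apply/allP => j _ /=.
rewrite mulf_neq0 // ?invr_eq0 pnatr_eq0 muln_eq0; last by lia.
(* The falling factorial is positive as r - j <= r + d - 2 - j, by d >= 2. *)
by rewrite negb_or -!lt0n fact_gt0 ffact_gt0; have := ltn_ord j; lia.
Qed.

Lemma coef0_dehom_Gform : (dehom (Gform (C := C) r d (generic_form C d)))`_0
  = (ratr kappa : C) *: h0 C d r.
Proof.
rewrite dehom_Gform -/(coefp 0 (\det _)) -det_map_mx.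
set w := \row_(j < r.+1) (s *+ (j`! * (r + d - 2 - j) ^_ (r - j))).
(* At x = 0 the mixed derivative in column j extracts the coefficient of x^j of C_i, with a scalar
   depending on j only. *)
have -> : map_mx (coefp 0) (covariant_mx r d s (dehom (generic_form C d)))
    = source_mx r d phi *m diag_mx w.
  apply/matrixP=> i j; rewrite mul_mx_diag !mxE /= coef0_mixed_deriv coefZ.
  rewrite mulrnAr [in RHS]mulrC; congr (_ * _ *+ _).
  rewrite coefB !coefMn coefXnM derivXn mulrnAl coefMn coefXnM coef_deriv.
  rewrite !coef_dehom_generic_form -!/(phi _); congr (_ - _).
    by case: ltnP => // _; rewrite ?mul0rn // -mulrnA mulnC.
  case: (nat_of_ord i) => [|k] /=; first by rewrite muln0 mulr0n mul0rn.
  by rewrite ltnS subSS; case: ltnP => // _; rewrite ?mul0rn // -mulrnA mulnC.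
have phi1E : phi 1 = a 1 *+ d by rewrite /phi bin1.
have phi0_neq0 : phi 0 != 0.
  rewrite /phi bin0 mulr1n; apply/eqP => /(congr1 (mcoeff U_(inord 0))).
  by rewrite mcoeffX eqxx mcoeff0 => /eqP; rewrite oner_eq0.
have pchar0 n : n.+1%:R != 0 :> Ca.
  by rewrite -mpolyC_nat mpolyC_eq0 pnatr_eq0.
rewrite det_mulmx det_diag (det_source_mx EplusM pchar0 r Eplus_phi phi1E phi0_neq0).
rewrite -h0_power_deriv mulrnAl.
have -> : \prod_(j < r.+1) w 0 j
  = (\prod_(j < r.+1) ((j`! * (r + d - 2 - j) ^_ (r - j))%:R / (r * d)%:R : C))%:A.
  rewrite -in_algE rmorph_prod; apply: eq_bigr => j _; rewrite mxE /s /=.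
  by rewrite scalerMnl mulr_natl.
have -> : ratr kappa = (\prod_(j < r.+1)
    ((j`! * (r + d - 2 - j) ^_ (r - j))%:R / (r * d)%:R)) * (d ^ r.+1)%:R :> C.
  rewrite /kappa rmorphM rmorph_prod /= ratr_nat; congr (_ * _).
  by apply: eq_bigr => j _; rewrite fmorph_div /= !ratr_nat.
by rewrite -scalerAr mulr1 mulrC -scalerA scaler_nat scalerMnr.
Qed.

(** Annihilation by [sl2_raise] reads E_+(g_k) = (k+1) g_(k+1), so the source determines every
    coefficient. *)
Lemma Eplus_coef_dehom_Gform k (g := dehom (Gform (C := C) r d (generic_form C d))) :
  iter k Eplus g`_0 = g`_k *+ k`!.
Proof.
have Es : Eplus s = 0 by rewrite /s linearZ /= (derivation1 EplusM) scaler0.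
have hg : sl2_raise Eplus g = 0.
  rewrite /g dehom_Gform.
  exact: (sl2_raise_covariant EplusM r d Es sl2_raise_generic_form).
elim: k => //= k ->; rewrite raddfMn /= factS mulrnA; congr (_ *+ _).
have := congr1 (fun q : {poly Ca} => q`_k) hg.
by rewrite coefB coef_map coef_deriv coef0 => /eqP; rewrite subr_eq0 => /eqP.
Qed.

Theorem Gform_Hform :
  Gform (C := C) r d (generic_form C d) = (ratr kappa : C)%:MP *: Hform C d r.
Proof.
rewrite [LHS](homog_dehomK homog_Gform) /Hform scaler_sumr; apply: eq_bigr => k _.
rewrite scalerA; congr (_ *: _).
have lkN : (k <= orderN d r)%N by rewrite -ltnS.
have fact_neq0 n : n`!%:R != 0 :> C by rewrite pnatr_eq0 -lt0n fact_gt0.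
apply: (scalerI (fact_neq0 k)).
rewrite scaler_nat -Eplus_coef_dehom_Gform coef0_dehom_Gform /hcoef.
have -> : iter k Eplus (ratr kappa *: h0 C d r) = ratr kappa *: iter k Eplus (h0 C d r).
  by elim: (nat_of_ord k) => //= n ->; rewrite linearZ.
rewrite mul_mpolyC [RHS]scalerA [k`!%:R * _]mulrC -[RHS]scalerA.
congr (ratr kappa *: _).
rewrite -scaler_nat !scalerA -[LHS]scale1r; congr (_ *: _).
(* The factor (N-k)!/N! of [hcoef] is inverse to k! C(N,k). *)
rewrite mulrA -!natrM (_ : k`! * 'C(orderN d r, k) * (orderN d r - k)`! = (orderN d r)`!)%N.
  by rewrite divff.
by rewrite -(bin_fact lkN) mulnA [(k`! * _)%N]mulnC.
Qed.

End GenericForm.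

Theorem theorem1p1 (R : realType) (r d : nat) (hr : (1 <= r)%N) (hd : (2 <= d)%N) :
  exists kappa : rat, kappa != 0 /\
    Gform r d (generic_form R[i] d) =
      (ratr kappa : R[i])%:MP *: Hform R[i] d r.
Proof.
exists (kappa d r); split; first exact: kappa_neq0.
exact: (@Gform_Hform R[i] d hd r hr).
Qed.
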